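(* Let $j,r\ge 0$ and $k\ge 1$ be integers with $j+r\le k$. Then \[ \sum_{s_1\ge\cdots\ge s_k\ge 0}\frac{q^{s_1^2+\cdots+s_k^2-s_1-\cdots-s_j+s_{k-r+1}+\cdots+s_k}}{(q)_{s_1-s_2}\cdots(q)_{s_{k-1}-s_k}(q)_{s_k}}=\sum_{f}q^{|f|}, \] where the sum on the right runs over all frequency sequences $f=(f_i)_{i\ge0}$ such that $f_i+f_{i+1}\le k$ for all $i\ge0$ and $f_0\le j-\max\{f_0+f_1-(k-r),0\}$.
   Context: A frequency sequence is a sequence $(f_i)_{i\ge0}$ of non-negative integers with only finitely many nonzero entries (equivalently, the multiplicities of the parts $0,1,2,\dots$ of a partition whose parts are non-negative integers); its size is $|f|=\sum_{i\ge0} i f_i$. $q$ is a complex number with $|q|<1$ (or a formal variable); $(a)_n=(a;q)_n=\prod_{m=0}^{n-1}(1-aq^m)$. $s_1+\cdots+s_j=\sum_{i=1}^j s_i$, $s_{k-r+1}+\cdots+s_k=\sum_{i=k-r+1}^k s_i$. *)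

(* Defs.v *)
From HB Require Import structures.
From mathcomp Require Import all_boot all_order all_algebra finmap.
From mathcomp Require Import complex.
From mathcomp Require Import all_classical all_reals all_analysis.
From mathcomp Require Import summability.

Set Implicit Arguments.
Unset Strict Implicit.
Unset Printing Implicit Defensive.

Import Order.TTheory GRing.Theory Num.Theory numFieldNormedType.Exports.

Local Open Scope classical_set_scope.
Local Open Scope ring_scope.

(* Unconditional convergence of the family (F x)_(x in A) with sum S: the
   finite partial sums converge to S along the finite subsets of T ordered by
   inclusion.  Over the complex numbers this amounts to absolute convergence. *)
Definition has_sum (K : numFieldType) (T : choiceType) (A : set T)
    (F : T -> K) (S : K) : Prop :=
  \sum_(x <- enum_fset B | x \in A) F x @[B --> totally] --> S.

Definition qpoch (K : fieldType) (a q : K) (n : nat) : K :=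
  \prod_(0 <= m < n) (1 - a * q ^+ m).

(* A k-tuple s is indexed from 0 in the library, whence the shift; since the
   default value is 0, this also gives s_(k+1) = 0, so that the last factor
   (q)_(s_k) of the denominator is (q)_(s_k - s_(k+1)). *)
Definition part (k : nat) (s : k.-tuple nat) (i : nat) : nat :=
  nth 0%N s i.-1.

Definition chains (k : nat) : set (k.-tuple nat) :=
  [set s | forall i, (1 <= i < k)%N -> (part s i.+1 <= part s i)%N].
Arguments chains : clear implicits.

(* The subtraction does not truncate, because s_i <= s_i ^ 2 and j <= k. *)
Definition exponent (j r k : nat) (s : k.-tuple nat) : nat :=
  (\sum_(1 <= i < k.+1) part s i ^ 2 - \sum_(1 <= i < j.+1) part s i
   + \sum_((k - r).+1 <= i < k.+1) part s i)%N.

Definition summand (K : fieldType) (q : K) (j r k : nat) (s : k.-tuple nat) :=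
  q ^+ exponent j r s /
  \prod_(1 <= i < k.+1) qpoch q q (part s i - part s i.+1).

Definition freqseq := {fsfun nat -> nat with 0%N}.

Definition freq_size (f : freqseq) : nat :=
  (\sum_(i <- enum_fset (finsupp f)) i * f i)%N.

(* The second inequality is between integers, since its right-hand side may be
   negative. *)
Definition admissible (j r k : nat) : set freqseq :=
  [set f : freqseq | (forall i, (f i + f i.+1 <= k)%N) /\
    (f 0%N)%:Z <=
      j%:Z - Num.max ((f 0%N)%:Z + (f 1%N)%:Z - (k%:Z - r%:Z)) 0].
Arguments admissible : clear implicits.

(* Main.v *)
Require Import Defs.
From HB Require Import structures.
From mathcomp Require Import all_boot all_order all_algebra finmap.
From mathcomp Require Import complex.
From mathcomp Require Import all_classical all_reals all_analysis.
From mathcomp Require Import summability ring zify.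
Import Order.TTheory GRing.Theory Num.Theory numFieldNormedType.Exports.
Local Open Scope ring_scope.
Local Open Scope complex_scope.

Set Implicit Arguments.
Unset Strict Implicit.
Unset Printing Implicit Defensive.

(* On sequences v, let T_a v be the convolution of
   x^s q^(s(s-1) + a s) v_s with u_n = 1/(q)_n, let S be the shift, and for a
   convolution v = g * u put lam v = sum_s g_s.  At x = 1 the left-hand side is
   lam (T_0^j T_1^(k-j-r) T_2^r u).  The commutation rule
     T_a T_(b+1) = T_(a+1) T_b + x q^a S T_(a+2) T_(b+1)
   and lam S = lam yield, for suitable pairs (w, w'),
     lam (T_0^(j+1) T_1^m w)
       = lam (T_0^j T_1^(m+1) w') + x^(j+1) lam (T_1^m T_2^(j+1) w).
   As x -> x q raises all indices by 1, A_r(x) = lam (T_1^(k-r) T_2^r u)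
   satisfies A_r(x) = sum_(b <= k-r) (x q)^b A_b(x q), which is how sequences
   with f_1 <= k - r and f_i + f_(i+1) <= k decompose along f_1 = b, while the
   left-hand side equals sum_(a <= j) A_(max(a, 2a+r-j))(1), the decomposition
   along f_0 = a.  Since A_r(x q^N) -> 1, iterating the recurrence identifies
   the limits, and the same argument for |q| gives absolute convergence. *)

(** * Abstract word calculus for the operators T_a, Q and S *)

Section Relations.
Variables (K : comNzRingType) (V : lmodType K) (x q : K).
Variables (S Q : {linear V -> V}) (T : nat -> {linear V -> V}).
Hypothesis TS : forall a v, T a (S v) = (x * q ^+ a) *: S (T a.+2 v).
Hypothesis TQ : forall a v, T a (Q v) = T a.+1 v.
Hypothesis QT : forall a v, Q (T a v) = T a.+1 v - S (T a.+1 v).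

(** Evaluate T_a Q T_b v twice: [TQ] absorbs Q into T_a, giving T_(a+1) T_b v, while [QT] moves it
    past T_b, giving T_a (1 - S) T_(b+1) v; [TS] then takes S to the left. *)
Lemma word_exchange a b v :
  T a (T b.+1 v) =
  T a.+1 (T b v) + (x * q ^+ a) *: S (T a.+2 (T b.+1 v)).
Proof. by rewrite -[T a.+1 _]TQ QT linearB TS subrK. Qed.

(* mixed m = sum_(t <= m) (x q)^t T_3^t T_2 T_1^(m-t): it commutes with T_2,
   and T_1^m T_2 = mixed m modulo the image of S - 1. *)
Fixpoint mixed (m : nat) (v : V) : V :=
  if m is m'.+1
  then T 2 (iter m (T 1) v) + (x * q) *: T 3 (mixed m' v)
  else T 2 v.

Lemma iter_T1_T2 m v :
  iter m (T 1) (T 2 v) =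
  T 2 (iter m (T 1) v) + S (mixed m v - T 2 (iter m (T 1) v)).
Proof.
elim: m => [|m IHm] /=; first by rewrite subrr linear0 addr0.
rewrite IHm linearD word_exchange TS expr1 -addrA -scalerDr -!linearD /=.
by rewrite [X in S (T 3 X)]addrC subrK addrAC subrr add0r linearZ.
Qed.

(** Both sides acquire the same correction, a multiple of S T_4 T_3 [mixed]: on the left from T_2
    crossing the S of [iter_T1_T2], on the right from exchanging T_2 with T_3. *)
Lemma mixed_T2 m v : mixed m (T 2 v) = T 2 (mixed m v).
Proof.
elim: m => [//|m IHm] /=; rewrite -iterS iter_T1_T2 /= IHm.
rewrite [X in S X]addrAC subrr add0r !linearD /= -!addrA; congr (_ + _).
rewrite !linearZ /= TS scalerA (word_exchange 2) scalerDr.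
by rewrite scalerA addrC [(x * q) * _]mulrC.
Qed.

Lemma mixed_iter_T2 m j v : mixed m (iter j (T 2) v) = iter j (T 2) (mixed m v).
Proof. by elim: j => //= j IHj; rewrite mixed_T2 IHj. Qed.

(** For m = 0 this is T_1 w' = T_0 Q w' = T_0 (w - S w). Then T_0 passes each T_1 by
    [word_exchange], and the corrections accumulate to [mixed m]. *)
Lemma T0_iter_T1 m w w' : Q w' = w - S w ->
  T 0 (iter m (T 1) w) = iter m.+1 (T 1) w' + x *: S (mixed m w).
Proof.
move=> hw; elim: m => [|m IHm] /=.
  by rewrite -TQ hw linearB TS expr0 mulr1 subrK.
rewrite word_exchange IHm expr0 mulr1 linearD /= -addrA; congr (_ + _).
rewrite linearZ /= TS expr1 -scalerDr; congr (_ *: _).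
by rewrite linearD /= linearZ /= addrC.
Qed.

(** A further T_0 on the left crosses S at the cost of a factor x and becomes T_2, which commutes
    with [mixed]. *)
Lemma iter_T0_iter_T1 j m w w' : Q w' = w - S w ->
  iter j.+1 (T 0) (iter m (T 1) w) =
  iter j (T 0) (iter m.+1 (T 1) w')
  + x ^+ j.+1 *: S (mixed m (iter j (T 2) w)).
Proof.
move=> hw; rewrite mixed_iter_T2.
elim: j => [|j IHj]; first by rewrite expr1 -T0_iter_T1.
rewrite iterS IHj linearD linearZ TS /= -[in RHS]iterS scalerA.
by rewrite expr0 mulr1 -exprSr.
Qed.

End Relations.

(** * The concrete operators on sequences *)

Section Operators.
Variables (K : fieldType) (q x : K).
Implicit Types (v w : nat -> K^o) (a n s : nat).

Definition seqshift v : nat -> K^o := fun n => if n is n'.+1 then v n' else 0.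
Definition qscale v : nat -> K^o := fun n => q ^+ n * v n.
Definition weight a v : nat -> K^o :=
  fun s => x ^+ s * q ^+ (s * s.-1 + a * s) * v s.
Definition qconv v : nat -> K^o :=
  fun n => \sum_(s < n.+1) v s / qpoch q q (n - s).
Definition bailey a v : nat -> K^o := qconv (weight a v).
Definition qfact_inv : nat -> K^o := fun n => (qpoch q q n)^-1.

Fact seqshift_is_linear : linear seqshift.
Proof.
move=> c v w; apply/funext => -[|n] //=.
by rewrite !fctE /= /seqshift scaler0 addr0.
Qed.
HB.instance Definition _ := GRing.isLinear.Build K _ _ _ seqshift seqshift_is_linear.

Fact qscale_is_linear : linear qscale.
Proof.
move=> c v w; apply/funext => n.
by rewrite !fctE /qscale mulrDr; congr (_ + _); exact: mulrCA.
Qed.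
HB.instance Definition _ :=
  GRing.isLinear.Build K _ _ _ qscale qscale_is_linear.

Fact weight_is_linear a : linear (weight a).
Proof.
move=> c v w; apply/funext => n.
by rewrite !fctE /weight mulrDr; congr (_ + _); exact: mulrCA.
Qed.
HB.instance Definition _ a :=
  GRing.isLinear.Build K _ _ _ (weight a) (weight_is_linear a).

Fact qconv_is_linear : linear qconv.
Proof.
move=> c v w; apply/funext => n; rewrite !fctE /qconv.
rewrite [X in X + _]big_distrr -big_split; apply: eq_bigr => s _ /=.
by rewrite mulrDl -mulrA.
Qed.
HB.instance Definition _ := GRing.isLinear.Build K _ _ _ qconv qconv_is_linear.

Fact bailey_is_linear a : linear (bailey a).
Proof. by move=> c v w; rewrite /bailey !linearP. Qed.
HB.instance Definition _ a :=
  GRing.isLinear.Build K _ _ _ (bailey a) (bailey_is_linear a).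

Lemma qpoch0 (b : K) : qpoch b q 0 = 1.
Proof. by rewrite /qpoch big_geq. Qed.

Lemma qpochS n : qpoch q q n.+1 = qpoch q q n * (1 - q ^+ n.+1).
Proof. by rewrite /qpoch big_nat_recr //= exprS. Qed.

Lemma qconv_shift v : qconv (seqshift v) = seqshift (qconv v).
Proof.
apply/funext => -[|n]; first by rewrite /qconv big_ord1 /= mul0r.
rewrite /qconv big_ord_recl /= mul0r add0r.
by apply: eq_bigr => i _; rewrite /bump leq0n subSS.
Qed.

(** The exponents match because (s+1)s + a(s+1) = s(s-1) + (a+2)s + a. *)
Lemma weight_shift a v :
  weight a (seqshift v) = (x * q ^+ a) *: seqshift (weight a.+2 v).
Proof.
apply/funext => -[|s]; first by rewrite fctE /weight /= !mulr0 scaler0.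
rewrite fctE /weight /= -[_ *: _]/(_ * _) !mulrA exprS; congr (_ * _).
rewrite (mulrAC x (q ^+ a)) -!mulrA -exprD; congr (_ * (_ * q ^+ _)).
case: s => [|s] /=; nia.
Qed.

(** With [bailey_qscale] and [qscale_bailey] this supplies the hypotheses [TS], [TQ] and [QT] of the
    abstract calculus. *)
Lemma bailey_shift a v :
  bailey a (seqshift v) = (x * q ^+ a) *: seqshift (bailey a.+2 v).
Proof. by rewrite /bailey weight_shift linearZ /= qconv_shift. Qed.

Lemma bailey_qscale a v : bailey a (qscale v) = bailey a.+1 v.
Proof.
rewrite /bailey; congr qconv; apply/funext => s; rewrite /weight /qscale.
by rewrite mulSn !exprD; ring.
Qed.

Hypothesis qfact_neq0 : forall n, qpoch q q n != 0.

(** On generating functions [qconv] multiplies by E(z) = sum of z^n/(q)_n, [qscale] replaces z by q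
    z and [seqshift] multiplies by z, so the identity amounts to E(q z) = (1 - z) E(z). *)
Lemma qscale_qconv v :
  qscale (qconv v) = qconv (qscale v) - seqshift (qconv (qscale v)).
Proof.
apply/funext => -[|n]; rewrite !fctE /qscale /qconv /=.
  by rewrite !big_ord1 subr0 expr0 subnn; ring.
rewrite big_ord_recr [X in _ = X - _]big_ord_recr /= !subnn qpoch0 !divr1.
rewrite mulrDr addrAC; congr (_ + _); rewrite -sumrB big_distrr /=.
apply: eq_bigr => s _; rewrite subSn ?leq_ord // qpochS.
have := qfact_neq0 (n - s).+1; rewrite qpochS mulf_eq0 negb_or => /andP[h1 h2].
have -> : q ^+ n.+1 = q ^+ s * q ^+ (n - s).+1.
  by rewrite -exprD addnS subnKC ?leq_ord.
by field; rewrite h1 h2.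
Qed.

Lemma qscale_bailey a v :
  qscale (bailey a v) = bailey a.+1 v - seqshift (bailey a.+1 v).
Proof.
rewrite /bailey qscale_qconv; have -> // : qscale (weight a v) = weight a.+1 v.
by apply/funext => s; rewrite /weight /qscale mulSn !exprD; ring.
Qed.

Lemma qscale_qfact_inv : qscale qfact_inv = qfact_inv - seqshift qfact_inv.
Proof.
apply/funext => -[|n]; rewrite fctE /qscale /qfact_inv /=.
  by rewrite subr0 mul1r.
rewrite -[LHS]/(_ * _) -[RHS]/(_ - _) /= qpochS.
have := qfact_neq0 n.+1; rewrite qpochS mulf_eq0 negb_or => /andP[h1 h2].
by field; rewrite h1 h2.
Qed.

(** The convolution is triangular with diagonal entries 1/(q)_0 = 1. This makes the value of [lam]
    unique. *)
Lemma qconv_inj : injective qconv.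
Proof.
move=> v w vw; apply/funext => n; elim/ltn_ind: n => n IHn.
move: (congr1 (fun f => f n) vw); rewrite /qconv !big_ord_recr /=.
rewrite subnn qpoch0 !divr1 (eq_bigr (fun i : 'I_n => w i / qpoch q q (n - i))).
  exact: addrI.
by move=> i _; rewrite IHn.
Qed.

End Operators.

(** The form of completeness behind the convergence arguments; as a hypothesis it lets them run over
    an abstract [numFieldType]. *)
Definition dominated_series_cvg (K : numFieldType) : Prop :=
  forall (F G : nat -> K) (M : K), (forall n, `|F n| <= G n) ->
    (forall n, series G n <= M) -> cvgn (series F).

(** * Dominated convergence of complex series *)

Section ComplexCompleteness.
Local Open Scope classical_set_scope.
Variable R : realType.
Let C : numFieldType := R[i].
Local Notation Re := (@complex.Re R).
Local Notation Im := (@complex.Im R).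

Lemma complex_cvg (u : nat -> C) (a b : R) :
  (fun n => Re (u n)) @ \oo --> a -> (fun n => Im (u n)) @ \oo --> b ->
  u @ \oo --> (a +i* b : C).
Proof.
(* In the order of [R[i]], [0 < e] forces [e] to be real, so [Re e / 2] can bound each
   coordinate. *)
move=> ua ub; apply/cvgrPdist_lt => e; rewrite ltcE /= => /andP[/eqP e0 egt0].
have e2 : 0 < Re e / 2 by rewrite divr_gt0.
move/cvgrPdist_lt: ua => /(_ _ e2) ua; move/cvgrPdist_lt: ub => /(_ _ e2) ub.
near=> n.
have han : `|a - Re (u n)| < Re e / 2 by near: n.
have hbn : `|b - Im (u n)| < Re e / 2 by near: n.
have -> : a +i* b - u n =
    (a - Re (u n))%:C + 'i%C * (b - Im (u n))%:C.
  by rewrite [LHS]complexE; case: (u n).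
have -> : e = (Re e / 2)%:C + (Re e / 2)%:C.
  by rewrite -rmorphD /= -splitr; case: (e) e0 => ? ? /= ->.
apply: le_lt_trans (ler_normD _ _) _; rewrite normrM.
have -> : `|'i%C : R[i]| = 1 by rewrite normc_def /= expr0n expr1n add0r sqrtr1.
rewrite mul1r !normc_def /= expr0n !addr0 !sqrtr_sqr -!rmorphD /=.
by rewrite ltcR ltrD.
Unshelve. all: by end_near.
Qed.

Lemma Re_le (z w : R[i]) : z <= w -> Re z <= Re w.
Proof. by rewrite lecE => /andP[]. Qed.

(** The real parts of [G] form a non-negative series with partial sums at most [Re M], and they
    dominate both the real and the imaginary parts of [F]. *)
Lemma complex_dominated_series_cvg : dominated_series_cvg C.
Proof.
move=> F G M FG GM.
have cvgG : cvgn (series (fun n => Re (G n))).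
  apply: nondecreasing_is_cvgn.
    apply: nondecreasing_series => n _ _; apply: (@Re_le 0).
    exact: le_trans (normr_ge0 _) (FG n).
  exists (Re M) => _ [n _ <-]; have := Re_le (GM n).
  by rewrite /series /= raddf_sum.
have cvg_part (u : nat -> R) : (forall n, `|u n| <= Re (G n)) -> cvgn (series u).
  move=> uG; apply: normed_cvg; apply: series_le_cvg cvgG => // n.
    exact: normr_ge0.
  exact: le_trans (normr_ge0 _) (uG n).
have cRe : cvgn (series (fun n => Re (F n))).
  apply: cvg_part => n; have := le_trans (normc_ge_Re _) (FG n).
  exact: Re_le.
have cIm : cvgn (series (fun n => Im (F n))).
  apply: cvg_part => n; apply: le_trans (Re_le (FG n)).
  rewrite normc_def /= -sqrtr_sqr ler_wsqrtr // lerDr; exact: sqr_ge0.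
apply/cvg_ex; exists (limn (series (fun n => Re (F n))) +i*
  limn (series (fun n => Im (F n)))).
apply: complex_cvg.
  have -> : (fun n => Re (series F n)) = series (fun n => Re (F n)) => //.
  by apply/funext => n; rewrite /series /= raddf_sum.
have -> : (fun n => Im (series F n)) = series (fun n => Im (F n)) => //.
by apply/funext => n; rewrite /series /= raddf_sum.
Qed.

End ComplexCompleteness.

(** * Estimates for 1/(q)_n and for Gaussian sums *)

Section Convergence.
Local Open Scope classical_set_scope.
Variables (K : numFieldType) (q : K).
Hypothesis (hK : dominated_series_cvg K) (hq : `|q| < 1).

Let D := (1 - `|q|)^-1.

Let D_ge1 : 1 <= D.
Proof. by rewrite /D invf_ge1 ?subr_gt0 // gerBl. Qed.

Let D_ge0 : 0 <= D. Proof. exact: le_trans ler01 D_ge1. Qed.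

Lemma one_sub_qX_norm n : 1 - `|q| <= `|1 - q ^+ n.+1|.
Proof.
apply: le_trans (lerB_dist _ _); rewrite normr1 lerD2l lerN2 normrX exprS.
by rewrite ler_piMr // exprn_ile1 // ltW.
Qed.

Lemma qfact_neq0 n : qpoch q q n != 0.
Proof.
elim: n => [|n IHn]; first by rewrite qpoch0 oner_eq0.
rewrite qpochS mulf_neq0 // -normr_gt0.
by apply: lt_le_trans (one_sub_qX_norm n); rewrite subr_gt0.
Qed.

Lemma qfact_inv_norm n : `|(qpoch q q n)^-1| <= D ^+ n.
Proof.
elim: n => [|n IHn]; first by rewrite qpoch0 invr1 normr1.
rewrite qpochS invfM normrM (exprSr D); apply: ler_pM => //.
rewrite normfV lef_pV2 ?one_sub_qX_norm // posrE ?subr_gt0 //.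
by apply: lt_le_trans (one_sub_qX_norm n); rewrite subr_gt0.
Qed.

(** Without an Archimedean property this rests on [hK]: the geometric series has partial sums at
    most [D], so it converges and its terms tend to 0. *)
Lemma expr_norm_small (e : K) : 0 < e -> exists m, `|q| ^+ m < e.
Proof.
move=> e0; have cvgS : cvgn (series (fun n => `|q| ^+ n)).
  apply: (hK (G := fun n => `|q| ^+ n) (M := D)) => n.
    by rewrite normrX normr_id.
  rewrite /series /= big_mkord.
  have h : 1 - `|q| != 0 by rewrite gt_eqF // subr_gt0.
  have -> : \sum_(i < n) `|q| ^+ i = (1 - `|q| ^+ n) / (1 - `|q|).
    apply: (mulfI h); rewrite mulrCA divff // mulr1.
    have := subrXX 1 `|q| n; rewrite expr1n => ->; congr (_ * _).
    by apply: eq_bigr => i _; rewrite expr1n mul1r.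
  by rewrite ler_piMl // gerBl exprn_ge0.
have /cvgrPdist_lt /(_ _ e0) [m _ hm] := cvg_series_cvg_0 cvgS.
by exists m; have := hm m (leqnn m); rewrite sub0r normrN normrX normr_id.
Qed.

(* The summands are (|q|^(s-1) c)^s, eventually at most 2^-s. *)
Lemma gaussian_sum_bounded (c : K) : 0 <= c ->
  exists2 M, 0 <= M &
    forall n, \sum_(s < n) `|q| ^+ (s * s.-1) * c ^+ s <= M.
Proof.
move=> c0; have c10 : 0 < 2 * c + 1 by rewrite ltr_wpDl // mulr_ge0.
have c1 : 0 < (2 * c + 1)^-1 by rewrite invr_gt0.
have [m hm] := expr_norm_small c1.
(* [C] absorbs the terms with s <= m; for s > m the choice of [m] gives |q|^(s-1) 2c <= 1. *)
pose C := (2 * c + 1) ^+ m.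
have C1 : 1 <= C by rewrite exprn_ege1 // lerDr mulr_ge0.
have step s : `|q| ^+ (s * s.-1) * c ^+ s <= C * 2^-1 ^+ s.
  have -> : c ^+ s = (2 * c) ^+ s * 2^-1 ^+ s.
    by rewrite -exprMn; congr (_ ^+ _); field.
  rewrite mulrA ler_wpM2r ?exprn_ge0 ?invr_ge0 //.
  have [sm|ms] := leqP s m.
    apply: (@le_trans _ _ ((2 * c) ^+ s)).
      rewrite ler_piMl ?exprn_ge0 ?mulr_ge0 // exprn_ile1 //; exact: ltW.
    apply: (@le_trans _ _ ((2 * c + 1) ^+ s)).
      by rewrite lerXn2r ?nnegrE ?mulr_ge0 ?(ltW c10) // lerDl.
    by rewrite ler_weXn2l // lerDr mulr_ge0.
  apply: le_trans C1; rewrite mulnC exprM -exprMn exprn_ile1 //.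
    by rewrite mulr_ge0 ?exprn_ge0 ?mulr_ge0.
  apply: (@le_trans _ _ ((2 * c + 1)^-1 * (2 * c + 1))); last first.
    by rewrite mulVf // gt_eqF.
  apply: ler_pM; rewrite ?exprn_ge0 ?mulr_ge0 ?lerDl //.
  apply: le_trans (ltW hm); rewrite -(subnKC (_ : m <= s.-1)%N); last by lia.
  by rewrite exprD ler_piMr ?exprn_ge0 // exprn_ile1 // ltW.
exists (C * 2); first by rewrite mulr_ge0 // (le_trans ler01).
move=> n; apply: (@le_trans _ _ (C * (2 - 2 * 2^-1 ^+ n))); last first.
  by rewrite ler_wpM2l ?(le_trans ler01 C1) // gerBl mulr_ge0 // exprn_ge0.
elim: n => [|n IHn]; first by rewrite big_ord0 expr0 mulr1 subrr mulr0.
rewrite big_ord_recr /=; apply: le_trans (lerD IHn (step n)) _.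
by rewrite -mulrDr exprS le_eqVlt; apply/orP; left; apply/eqP; field.
Qed.

End Convergence.

(** * The functional lam and the exchange identity *)

Section Lam.
Local Open Scope classical_set_scope.
Variables (K : numFieldType) (q : K).
Hypothesis (hK : dominated_series_cvg K) (hq : `|q| < 1).
Implicit Types (v w : nat -> K^o) (l : K).

(** A relation rather than a function, since the series of [g] may diverge. *)
Definition lam v l :=
  exists2 g : nat -> K^o, v = qconv q g & series g @ \oo --> (l : K^o).

Lemma lam_unique v l l' : lam v l -> lam v l' -> l = l'.
Proof.
move=> [g -> gl] [g' /(qconv_inj) gg' gl'].
by move: gl; rewrite gg' => gl; apply: cvg_unique gl gl'; exact: norm_hausdorff.
Qed.

Lemma lamD v w l l' : lam v l -> lam w l' -> lam (v + w) (l + l').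
Proof.
move=> [g -> gl] [g' -> gl']; exists (g + g'); first by rewrite linearD.
have -> : series (g + g') = series g + series g'.
  by apply/funext => n; exact: big_split.
exact: cvgD.
Qed.

Lemma lamZ (c : K) v l : lam v l -> lam (c *: v) (c * l).
Proof.
move=> [g -> gl]; exists (c *: g); first by rewrite linearZ.
have -> : series (c *: g) = c *: series g.
  by apply/funext => n; rewrite -[RHS]/(c * _) [RHS]big_distrr.
exact: cvgZl_tmp.
Qed.

Lemma lamN v l : lam v l -> lam (- v) (- l).
Proof. by move/(lamZ (-1)); rewrite scaleN1r mulN1r. Qed.

(** The shift commutes with the convolution and only prepends a zero to [g]. *)
Lemma lam_shift v l : lam v l -> lam (seqshift v) l.
Proof.
move=> [g -> gl]; exists (seqshift g); first by rewrite qconv_shift.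
rewrite -cvg_shiftS; apply: cvg_trans gl; apply: near_eq_cvg; near=> n.
by rewrite /series /= big_nat_recl //= add0r.
Unshelve. all: by end_near.
Qed.

(* The growth 1/(1-|q|)^n is that of 1/(q)_n; every T_a preserves it. *)
Definition tame v := exists C, forall n, `|v n| <= C * (1 - `|q|)^-1 ^+ n.

Let D_ge0 : 0 <= (1 - `|q|)^-1.
Proof. by rewrite invr_ge0 subr_ge0 ltW. Qed.

Lemma tame_qfact_inv : tame (qfact_inv q).
Proof. by exists 1 => n; rewrite mul1r qfact_inv_norm. Qed.

Lemma tameD v w : tame v -> tame w -> tame (v + w).
Proof.
move=> [C hC] [C' hC']; exists (C + C') => n; rewrite mulrDl.
exact: le_trans (ler_normD _ _) (lerD (hC n) (hC' n)).
Qed.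

Lemma tameZ (c : K) v : tame v -> tame (c *: v).
Proof.
move=> [C hC]; exists (`|c| * C) => n; rewrite -mulrA.
by rewrite -[(c *: v) n]/(c * v n) normrM ler_wpM2l.
Qed.

Variable x : K.
Hypothesis hx : `|x| <= 1.

Lemma weight_norm a v s :
  `|weight q x a v s| <= `|q| ^+ (s * s.-1) * `|v s|.
Proof.
rewrite /weight !normrM ler_wpM2r // !normrX exprD mulrCA.
rewrite ler_piMr ?exprn_ge0 // mulr_ile1 ?exprn_ge0 ?exprn_ile1 //.
exact: ltW.
Qed.

(** The factor |q|^(s(s-1)) outweighs the geometric growth of a tame sequence. *)
Lemma cvg_weight a v : tame v -> cvgn (series (weight q x a v)).
Proof.
move=> [C hC].
have C0 : 0 <= C by have := hC 0%N; rewrite expr0 mulr1; apply: le_trans.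
have [M M0 hM] := gaussian_sum_bounded hK hq D_ge0.
apply: (hK (M := C * M)
  (G := fun s => C * (`|q| ^+ (s * s.-1) * (1 - `|q|)^-1 ^+ s))) => [s|n].
  apply: le_trans (weight_norm _ _ _) _.
  by rewrite mulrCA ler_wpM2l ?exprn_ge0.
by rewrite /series /= big_mkord -mulr_sumr ler_wpM2l.
Qed.

(** With D = 1/(1-|q|), splitting D^n as D^s D^(n-s) keeps the growth rate and costs only the factor
    [M]. The constants are explicit so that [word_bounded] can be uniform in [x]. *)
Lemma bailey_norm (M C : K) a v : 0 <= C ->
  (forall n, \sum_(s < n) `|q| ^+ (s * s.-1) * 1 ^+ s <= M) ->
  (forall n, `|v n| <= C * (1 - `|q|)^-1 ^+ n) ->
  forall n, `|bailey q x a v n| <= C * M * (1 - `|q|)^-1 ^+ n.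
Proof.
move=> C0 hM hC n; rewrite /bailey /qconv.
apply: le_trans (ler_norm_sum _ _ _) _.
apply: (@le_trans _ _ (\sum_(s < n.+1)
  C * (`|q| ^+ (s * s.-1) * 1 ^+ s) * (1 - `|q|)^-1 ^+ n)); last first.
  by rewrite -mulr_suml -mulr_sumr ler_wpM2r ?exprn_ge0 // ler_wpM2l.
apply: ler_sum => s _; rewrite normrM.
apply: le_trans (ler_pM _ _ (weight_norm a v s) (qfact_inv_norm hq (n - s))) _ => //.
have -> : (1 - `|q|)^-1 ^+ n = (1 - `|q|)^-1 ^+ s * (1 - `|q|)^-1 ^+ (n - s).
  by rewrite -exprD subnKC ?leq_ord.
rewrite expr1n mulr1 mulrA ler_wpM2r ?exprn_ge0 //.
by rewrite [leRHS]mulrAC mulrC ler_wpM2r ?exprn_ge0.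
Qed.

Lemma tame_bailey a v : tame v -> tame (bailey q x a v).
Proof.
move=> [C hC].
have C0 : 0 <= C by have := hC 0%N; rewrite expr0 mulr1; apply: le_trans.
have [M M0 hM] := gaussian_sum_bounded hK hq ler01.
by exists (C * M); exact: bailey_norm.
Qed.

Lemma lam_bailey a v : tame v ->
  lam (bailey q x a v) (limn (series (weight q x a v))).
Proof. by move=> hv; exists (weight q x a v) => //; exact: cvg_weight. Qed.

Lemma tame_iter_bailey a n v : tame v -> tame (iter n (bailey q x a) v).
Proof. by move=> hv; elim: n => //= n; exact: tame_bailey. Qed.

Local Notation S := (@seqshift K).
Local Notation T := (@bailey K q x).
Local Notation U := (mixed x q (fun a => T a : {linear _ -> _})).

Lemma tame_mixed m v : tame v -> tame (U m v).
Proof.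
move=> hv; elim: m => [|m IHm] /=; first exact: tame_bailey.
apply: tameD; first exact: (tame_bailey 2 (tame_iter_bailey 1 m.+1 hv)).
by apply: tameZ; apply: tame_bailey.
Qed.

Lemma lam_mixed m v : tame v -> exists l, lam (U m v) l.
Proof.
move=> hv; case: m => [|m] /=; first by eexists; apply: lam_bailey.
eexists; apply: lamD.
  exact: lam_bailey (tame_iter_bailey 1 m.+1 hv).
by apply/lamZ/lam_bailey/tame_mixed.
Qed.

Lemma lam_exchange j m w w' l1 l2 l3 :
  tame w -> qscale q w' = w - S w ->
  lam (iter j.+1 (T 0) (iter m (T 1) w)) l1 ->
  lam (iter j (T 0) (iter m.+1 (T 1) w')) l2 ->
  lam (iter m (T 1) (iter j.+1 (T 2) w)) l3 ->
  l1 = l2 + x ^+ j.+1 * l3.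
Proof.
move=> tw ww' h1 h2 h3.
have TS := @bailey_shift K q x; have TQ := @bailey_qscale K q x.
have QT := @qscale_bailey K q x (qfact_neq0 hq).
have [l hl] := lam_mixed m (tame_iter_bailey 2 j tw).
(* By [iter_T1_T2], replacing T_1^m T_2 by [mixed m] changes the sequence by an element of the image
   of S - 1, on which lam vanishes. *)
have -> : l3 = l.
  apply: (lam_unique h3); rewrite iterS.
  rewrite (@iter_T1_T2 _ _ x q S (qscale q) T TS TQ QT).
  have [l' hl'] : exists l', lam (T 2 (iter m (T 1) (iter j (T 2) w))) l'.
    by eexists; apply: lam_bailey; do 2!apply: tame_iter_bailey.
  rewrite -(subrKC l' l); apply: lamD => //; apply: lam_shift.
  by apply: lamD hl _; exact: lamN.
apply: (lam_unique h1).
rewrite (@iter_T0_iter_T1 _ _ x q S (qscale q) T TS TQ QT _ _ _ _ ww').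
by apply: lamD h2 _; apply/lamZ/lam_shift.
Qed.

End Lam.

(** * Words T_(c_1) ... T_(c_k) u and their lam-values *)

Section Words.
Local Open Scope classical_set_scope.
Variables (K : numFieldType) (q : K).

Definition word (x : K) (cs : seq nat) : nat -> K^o :=
  foldr (bailey q x) (qfact_inv q) cs.

(** This is lam of the word: the outermost convolution is left off and the weights are summed. The
    empty word gets 1 because u is the convolution of u with the unit sequence at 0. *)
Definition wsum (x : K) (cs : seq nat) : K :=
  if cs is c :: cs' then limn (series (weight q x c (word x cs'))) else 1.

Lemma word_nseq_cat x n a cs :
  word x (nseq n a ++ cs) = iter n (bailey q x a) (word x cs).
Proof. by elim: n => //= n <-. Qed.

Lemma weight_mulq x a v : weight q (x * q) a v = weight q x a.+1 v.
Proof.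
by apply/funext => s; rewrite /weight mulSn !exprD exprMn; ring.
Qed.

Lemma word_mulq x cs : word (x * q) cs = word x (map S cs).
Proof.
by elim: cs => //= c cs ->; rewrite /bailey weight_mulq.
Qed.

Lemma wsum_mulq x cs : wsum (x * q) cs = wsum x (map S cs).
Proof. by case: cs => //= c cs; rewrite weight_mulq word_mulq. Qed.

Hypothesis (hK : dominated_series_cvg K) (hq : `|q| < 1).

Section FixedX.
Variable x : K.
Hypothesis hx : `|x| <= 1.

Lemma tame_word cs : tame q (word x cs).
Proof.
elim: cs => [|c cs IHcs] /=; first exact: tame_qfact_inv.
exact: tame_bailey.
Qed.

Lemma lam_word c cs : lam q (word x (c :: cs)) (wsum x (c :: cs)).
Proof. exact/lam_bailey/tame_word. Qed.

(** The pair is w = T_2 v, w' = T_1 v with v = T_2^r u, suitable by [qscale_bailey]. *)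
Lemma wsum_exchange j m r :
  wsum x (nseq j.+1 0 ++ nseq m 1 ++ nseq r.+1 2)%N =
  wsum x (nseq j 0 ++ nseq m.+2 1 ++ nseq r 2)%N
  + x ^+ j.+1 * wsum x (nseq m 1 ++ nseq (j + r).+2 2)%N.
Proof.
apply: (@lam_exchange _ _ hK hq x hx j m (word x (nseq r.+1 2%N))
  (word x (1%N :: nseq r 2%N))).
- exact: tame_word.
- exact/qscale_bailey/qfact_neq0.
- by rewrite -!word_nseq_cat; exact: lam_word.
- have e : (nseq m.+1 1 ++ 1 :: nseq r 2 = nseq m.+2 1 ++ nseq r 2)%N.
    by elim: m => //= m ->.
  by rewrite -!word_nseq_cat e; case: j => [|j]; exact: lam_word.
- rewrite -!word_nseq_cat -nseqD addSn addnS; case: m => [|m]; exact: lam_word.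
Qed.

(** Here w = w' = u, suitable since q^n u_n = u_n - u_(n-1). *)
Lemma wsum_exchange0 j m :
  wsum x (nseq j.+1 0 ++ nseq m 1)%N =
  wsum x (nseq j 0 ++ nseq m.+1 1)%N
  + x ^+ j.+1 * wsum x (nseq m 1 ++ nseq j.+1 2)%N.
Proof.
apply: (@lam_exchange _ _ hK hq x hx j m (word x [::]) (word x [::])).
- exact: tame_word.
- exact/qscale_qfact_inv/qfact_neq0.
- by rewrite -!word_nseq_cat cats0; exact: lam_word.
- by rewrite -!word_nseq_cat cats0; case: j => [|j]; exact: lam_word.
- by rewrite -!word_nseq_cat cats0; case: m => [|m]; exact: lam_word.
Qed.

End FixedX.

(* The series A_r(x) of the header. *)
Definition agsum (k : nat) (x : K) (r : nat) : K :=
  wsum x (nseq (k - r) 1 ++ nseq r 2)%N.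

(** Written at x q, A_r(x) is lam (T_0^(k-r) T_1^r u). One exchange splits off the term b = k - r
    and leaves A_(r+1)(x); the induction starts from A_k(x) = A_0(x q). *)
Lemma agsum_rec k x r : `|x| <= 1 -> (r <= k)%N ->
  agsum k x r = \sum_(b < (k - r).+1) (x * q) ^+ b * agsum k (x * q) b.
Proof.
move=> hx rk; have hxq : `|x * q| <= 1.
  by rewrite normrM mulr_ile1 // ltW.
have map_nseqS n a : map S (nseq n a) = nseq n a.+1 by rewrite map_nseq.
have [n hn] : exists n, (k - r)%N = n by exists (k - r)%N.
rewrite hn; elim: n r rk hn => [|n IHn] r rk hn.
  have -> : r = k by lia.
  rewrite big_ord1 expr0 mul1r /agsum wsum_mulq map_cat !map_nseqS.
  by rewrite subnn subn0 cats0.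
rewrite big_ord_recr /= -(IHn r.+1) ?subnS ?hn //; last by lia.
have := wsum_exchange0 hxq n r; rewrite !wsum_mulq !map_cat !map_nseqS.
rewrite /agsum subnS hn -[n.+1.-1]/n => ->.
rewrite [in RHS]wsum_mulq map_cat !map_nseqS.
by have -> : r = (k - n.+1)%N by lia.
Qed.

(* The truncated subtraction is harmless, the maximum being at least a. *)
Lemma wsum_agsum j m r :
  wsum 1 (nseq j 0 ++ nseq m 1 ++ nseq r 2)%N =
  \sum_(a < j.+1) agsum (j + m + r) 1 (maxn a (a.*2 + r - j)).
Proof.
elim: j m r => [|j IHj] m r.
  by rewrite big_ord1 /agsum /= add0n subn0 max0n addnK.
have h1 : `|1 : K| <= 1 by rewrite normr1.
(* The exchange splits off the term a = j + 1. For r = 0 the remaining 2a - j and 2a - (j+1) differ,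
   but both are at most a when a <= j. *)
rewrite big_ord_recr [X in _ = _ + X]/=; case: r => [|r].
  rewrite cats0 wsum_exchange0 // expr1n mul1r.
  rewrite -[in X in X + _ = _](cats0 (nseq m.+1 1%N)) (IHj m.+1 0%N).
  congr (_ + _).
    apply: eq_bigr => a _; congr agsum; have := ltn_ord a => /=; lia.
  rewrite /agsum; congr wsum; congr (nseq _ _ ++ nseq _ _); lia.
rewrite wsum_exchange // expr1n mul1r (IHj m.+2 r); congr (_ + _).
  apply: eq_bigr => a _; congr agsum; have := ltn_ord a => /=; lia.
rewrite /agsum; congr wsum; congr (nseq _ _ ++ nseq _ _); lia.
Qed.

End Words.

(** * Values of words for small x *)

Section NearOne.
Local Open Scope classical_set_scope.
Variables (K : numFieldType) (q : K).
Hypothesis (hK : dominated_series_cvg K) (hq : `|q| < 1).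

(** The constant depends on the length of the word alone, so it serves all the points q^i of the
    iteration at once. *)
Lemma word_bounded n : exists2 C, 0 <= C &
  forall (x : K) cs s, `|x| <= 1 -> size cs = n ->
    `|word q x cs s| <= C * (1 - `|q|)^-1 ^+ s.
Proof.
have [M M0 hM] := gaussian_sum_bounded hK hq ler01.
elim: n => [|n [C C0 IHn]].
  exists 1 => // x [|//] s hx _; rewrite mul1r; exact: qfact_inv_norm.
exists (C * M); first exact: mulr_ge0.
move=> x [//|c cs] s hx [hcs] /=; apply: bailey_norm => // i.
exact: IHn.
Qed.

Lemma word_0 (x : K) cs : word q x cs 0 = 1.
Proof.
elim: cs => [|c cs /= IHcs]; first by rewrite /= /qfact_inv qpoch0 invr1.
rewrite /bailey /qconv big_ord1 /weight IHcs subn0 qpoch0 expr0 !muln0 expr0.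
by rewrite !mulr1 divr1.
Qed.

(** The term s = 0 equals 1 by [word_0], and every other term contains a factor x. *)
Lemma wsum_near1 n : exists2 M, 0 <= M &
  forall (x : K) cs, `|x| <= 1 -> size cs = n -> `|wsum q x cs - 1| <= `|x| * M.
Proof.
case: n => [|n].
  by exists 0 => // x [|//] _ _; rewrite mulr0 subrr normr0.
have [C C0 hC] := word_bounded n.
have D0 : 0 <= (1 - `|q|)^-1 by rewrite invr_ge0 subr_ge0 ltW.
have [M M0 hM] := gaussian_sum_bounded hK hq D0.
exists (C * M); first exact: mulr_ge0.
move=> x [//|c cs] hx [hcs].
have hs N : `|series (weight q x c (word q x cs)) N.+1 - 1| <= `|x| * (C * M).
  rewrite /series /= big_mkord big_ord_recl {1}/weight word_0 !muln0 !expr0.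
  rewrite !mulr1 addrC addKr; apply: le_trans (ler_norm_sum _ _ _) _.
  have hMN : \sum_(s < N) `|q| ^+ (s.+1 * s) * (1 - `|q|)^-1 ^+ s.+1 <= M.
    apply: le_trans (hM N.+1); rewrite big_ord_recl /= lerDr.
    by rewrite mulr_ge0 ?exprn_ge0.
  apply: (@le_trans _ _ (\sum_(s < N) `|x| * (C * (`|q| ^+ (s.+1 * s)
    * (1 - `|q|)^-1 ^+ s.+1)))).
    apply: ler_sum => s _; rewrite lift0 /weight !normrM !normrX /=.
    rewrite exprS -!mulrA ler_wpM2l //.
    rewrite exprD mulrCA [leRHS]mulrCA -!mulrA ler_wpM2l ?exprn_ge0 //.
    rewrite mulrA -[leRHS]mul1r ler_pM ?mulr_ge0 ?exprn_ge0 //; last exact: hC.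
    by rewrite mulr_ile1 ?exprn_ge0 ?exprn_ile1 // ltW.
  by rewrite -!mulr_sumr !ler_wpM2l.
have /cvgrPdist_lt hl := cvg_weight hK hq hx (a := c) (tame_word hK hq hx cs).
apply/ler_addgt0Pr => e e0; have [m _ hm] := hl _ e0.
rewrite -(subrKA (series (weight q x c (word q x cs)) m.+1)).
apply: le_trans (ler_normD _ _) _; rewrite addrC lerD //.
by apply/ltW/hm => /=.
Qed.

End NearOne.

(** * Iterating the recurrence towards the frequency sums *)

Section Frequencies.
Local Open Scope classical_set_scope.
Variable K : numFieldType.
Hypothesis hK : dominated_series_cvg K.

(* The sum of q^((i+1) f_(i+1) + ... + (i+N) f_(i+N)) over the sequences with
   f_(i+1) <= k - b and consecutive sums at most k. *)
Fixpoint freqsum (q : K) (k N b i : nat) : K :=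
  if N is N'.+1 then
    \sum_(c < (k - b).+1) q ^+ (i.+1 * c) * freqsum q k N' c i.+1
  else 1.

Lemma freqsum_ge0 (p : K) k N b i : 0 <= p -> 0 <= freqsum p k N b i.
Proof.
move=> p0; elim: N b i => //= N IHN b i.
by apply: sumr_ge0 => c _; rewrite mulr_ge0 ?exprn_ge0.
Qed.

(** [freqsum] obeys the recurrence [agsum_rec], so after N steps the only error comes from replacing
    each A_c(q^(i+N)) by 1. *)
Lemma freqsum_dist (q M : K) k N b i : `|q| < 1 ->
  (forall (x : K) cs, `|x| <= 1 -> size cs = k -> `|wsum q x cs - 1| <= `|x| * M) ->
  (b <= k)%N ->
  `|agsum q k (q ^+ i) b - freqsum q k N b i|
     <= freqsum `|q| k N b i * (`|q| ^+ (i + N) * M).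
Proof.
move=> hq hM; have hX n : `|q ^+ n| <= 1 by rewrite normrX exprn_ile1 // ltW.
elim: N b i => [|N IHN] b i bk /=.
  rewrite mul1r addn0 -normrX; apply: hM => //.
  by rewrite size_cat !size_nseq subnK.
rewrite agsum_rec // -exprSr -sumrB; apply: le_trans (ler_norm_sum _ _ _) _.
rewrite mulr_suml; apply: ler_sum => c _; rewrite -exprM -mulrBr normrM normrX.
rewrite -mulrA ler_wpM2l ?exprn_ge0 // addnS -addSn; apply: IHN.
by apply: leq_trans (leq_ord c) _; exact: leq_subr.
Qed.

(* For N large, |A_b - freqsum N| <= freqsum N / 2, so freqsum N <= 2 |A_b|. *)
Lemma freqsum_bounded (p : K) k b i : 0 <= p -> p < 1 -> (b <= k)%N ->
  exists2 B, 0 <= B & \forall N \near \oo, freqsum p k N b i <= B.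
Proof.
move=> p0 p1 bk; have pE : `|p| = p by rewrite ger0_norm.
have hp : `|p| < 1 by rewrite pE.
have [M M0 hM] := wsum_near1 hK hp k.
have M1 : 0 < 2 * (M + 1) by rewrite mulr_gt0 // ltr_wpDl.
have M2 : 0 < (2 * (M + 1))^-1 by rewrite invr_gt0.
have [m hm] := expr_norm_small hK hp M2.
exists (2 * `|agsum p k (p ^+ i) b|); first by rewrite mulr_ge0.
exists m => // N /= mN; set Z := freqsum p k N b i.
have Z0 : 0 <= Z by exact: freqsum_ge0.
have : `|agsum p k (p ^+ i) b - Z| <= Z * 2^-1.
  apply: le_trans (freqsum_dist _ _ hp hM bk) _; rewrite pE ler_wpM2l //.
  apply: (@le_trans _ _ ((2 * (M + 1))^-1 * (M + 1))); last first.
    by rewrite invfM -mulrA mulVf ?mulr1 // gt_eqF // ltr_wpDl.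
  apply: ler_pM; rewrite ?exprn_ge0 ?lerDl //.
  rewrite -(subnKC mN) addnCA exprD; apply: le_trans (ltW hm).
  by rewrite pE ler_piMr ?exprn_ge0 // exprn_ile1 // ltW.
move=> h; have : Z - `|agsum p k (p ^+ i) b| <= Z * 2^-1.
  by apply: le_trans h; rewrite distrC -[X in X - _](ger0_norm Z0) lerB_dist.
rewrite lerBlDl addrC -lerBlDl => h'.
have -> : Z = 2 * (Z - Z * 2^-1) by field.
by rewrite ler_wpM2l.
Qed.

(** A bound [B] on the sums for |q| makes the error of [freqsum_dist] at most B M |q|^(i+N) for
    large N. *)
Lemma cvg_freqsum (q : K) k b i : `|q| < 1 -> (b <= k)%N ->
  (fun N => freqsum q k N b i) @ \oo --> (agsum q k (q ^+ i) b : K^o).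
Proof.
move=> hq bk; have [M M0 hM] := wsum_near1 hK hq k.
have [B B0 [m _ hB]] := freqsum_bounded i (normr_ge0 q) hq bk.
apply/cvgrPdist_lt => e e0; have c0 : 0 < B * M + 1 by rewrite ltr_wpDl ?mulr_ge0.
have [m' hm'] := expr_norm_small hK hq (divr_gt0 e0 c0).
exists (m + m')%N => // N /= hN.
apply: le_lt_trans (freqsum_dist _ _ hq hM bk) _.
apply: (@le_lt_trans _ _ (B * (`|q| ^+ m' * M))).
  apply: ler_pM; rewrite ?freqsum_ge0 ?mulr_ge0 ?exprn_ge0 //.
    by apply: hB => /=; lia.
  rewrite ler_wpM2r // -(subnKC (_ : m' <= i + N)%N); last by lia.
  by rewrite exprD ler_piMr ?exprn_ge0 // exprn_ile1 // ltW.
rewrite mulrCA; apply: le_lt_trans (_ : `|q| ^+ m' * (B * M + 1) < e).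
  by rewrite ler_wpM2l ?exprn_ge0 // lerDl.
by rewrite -ltr_pdivlMr.
Qed.

End Frequencies.

(** * Unconditional sums from a dominated exhaustion *)

Section Exhaustion.
Local Open Scope classical_set_scope.
Variables (K : numFieldType) (T : choiceType).

Lemma big_sub_uniq (F : T -> K) (s t : seq T) : uniq s -> uniq t ->
  {subset s <= t} ->
  \sum_(x <- t) F x = \sum_(x <- s) F x + \sum_(x <- t | x \notin s) F x.
Proof.
move=> us ut st; rewrite (bigID (mem s)) /=; congr (_ + _).
rewrite -big_filter; apply: perm_big; apply: uniq_perm => // [|x].
  exact: filter_uniq.
by rewrite mem_filter; case: (boolP (x \in s)) => //= /st ->.
Qed.

(** If a finite set contains B_m, its part in [A] lies in some B_n because the B_n increase. The
    excess over B_m is then bounded by the sum of [G] over B_n minus B_m, which is small as the sums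
    of [G] converge. *)
Lemma has_sum_exhaustion (A : set T) (F G : T -> K) (B : nat -> seq T) (S L : K) :
  (forall n, uniq (B n)) -> (forall n, {subset B n <= B n.+1}) ->
  (forall x, A x <-> exists n, x \in B n) ->
  (forall x, `|F x| <= G x) ->
  (fun n => \sum_(x <- B n) F x) @ \oo --> S ->
  (fun n => \sum_(x <- B n) G x) @ \oo --> L ->
  has_sum A F S.
Proof.
move=> uB BS AB FG FS GL; have G0 x : 0 <= G x by apply: le_trans (FG x).
have homoB m n : (m <= n)%N -> {subset B m <= B n}.
  move=> /subnKC <-; elim: (n - m)%N => [|d IHd]; first by rewrite addn0.
  by move=> x /IHd; rewrite addnS; exact: BS.
have ? := @totally_filter T.
apply/cvgrPdist_lt => e e0; have e2 : 0 < e / 2 / 2 by rewrite !divr_gt0.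
have e4 : 0 < e / 2 by rewrite divr_gt0.
have [m1 _ hF] := (cvgrPdist_lt _ _).1 FS _ e4.
have [m2 _ hG] := (cvgrPdist_lt _ _).1 GL _ e2.
pose m := maxn m1 m2.
exists [fset x in B m]%fset => // C /= /fsubsetP BC.
have {}BC : {subset B m <= enum_fset C} by move=> x xB; apply: BC; rewrite inE.
pose C0 := [seq x <- enum_fset C | x \in A].
have uC0 : uniq C0 by rewrite filter_uniq // fset_uniq.
have BC0 : {subset B m <= C0}.
  move=> x xB; rewrite mem_filter BC // andbT; apply/mem_set/AB; by exists m.
have [n mn C0n] : exists2 n, (m <= n)%N & {subset C0 <= B n}.
  have : forall x, x \in C0 -> A x.
    by move=> x; rewrite mem_filter => /andP[/set_mem].
  elim: C0 {uC0 BC0} => [|x s IHs] sA; first by exists m.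
  have [n mn sn] := IHs (fun y ys => sA y (mem_behead (s := x :: s) ys)).
  have [n' xn'] := (AB x).1 (sA x (mem_head _ _)).
  exists (maxn n n'); first by rewrite leq_max mn.
  move=> y; rewrite inE => /orP[/eqP ->|/sn yn].
    by apply: homoB xn'; rewrite leq_maxr.
  by apply: homoB yn; rewrite leq_maxl.
rewrite -big_filter -/C0 (big_sub_uniq F (uB m) uC0 BC0).
rewrite opprD addrA; apply: le_lt_trans (ler_normB _ _) _.
rewrite (splitr e) ltrD //; first by apply: hF; exact: leq_maxl.
apply: le_lt_trans (ler_norm_sum _ _ _) _.
apply: le_lt_trans (ler_sum _ (fun x _ => FG x)) _.
apply: (@le_lt_trans _ _ (\sum_(x <- B n | x \notin B m) G x)).
  rewrite -big_filter -[leRHS]big_filter.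
  rewrite [leRHS](@big_sub_uniq G [seq x <- C0 | x \notin B m]) ?filter_uniq //.
    by rewrite lerDl sumr_ge0.
  by move=> x; rewrite mem_filter => /andP[xm /C0n xn]; rewrite mem_filter xm.
have h := big_sub_uniq G (uB m) (uB n) (homoB _ _ mn).
rewrite -[ltLHS]ger0_norm ?sumr_ge0 //.
have -> : \sum_(x <- B n | x \notin B m) G x =
    (L - \sum_(x <- B m) G x) - (L - \sum_(x <- B n) G x) by rewrite h; ring.
apply: le_lt_trans (ler_normB _ _) _; rewrite (splitr (e / 2)) ltrD //.
  by apply: hG; exact: leq_maxr.
by apply: hG; apply: leq_trans mn; exact: leq_maxr.
Qed.

End Exhaustion.

(** * Expanding words as sums over chains *)

Section ChainEnumeration.

(** The recursion copies the nested sums of [qconv], so words expand term by term. *)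
Fixpoint chain_enum (k n : nat) : seq (k.-tuple nat) :=
  if k is k'.+1 then [seq cons_tuple s t | s <- iota 0%N n.+1, t <- chain_enum k' s]
  else [:: [tuple]].

Lemma chain_enum_uniq k n : uniq (chain_enum k n).
Proof.
elim: k n => [//|k IHk] n; apply: allpairs_uniq_dep => [|s _|].
- exact: iota_uniq.
- exact: IHk.
move=> [s t] [s' t'] _ _ /= /(congr1 val) [-> e].
by have -> : t = t' by apply: val_inj.
Qed.

Lemma mem_chain_enum k n (t : k.-tuple nat) :
  (t \in chain_enum k n) = path geq n t.
Proof.
elim: k n t => [|k IHk] n t; first by rewrite (tuple0 t) inE.
case/tupleP: t => s t; apply/allpairsPdep/idP.
  move=> [s' [t' [hs ht /(congr1 val) /= [-> e]]]].
  move: hs; rewrite mem_iota add0n ltnS => /= -> /=; rewrite -(IHk s' t).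
  by have -> : t = t' by apply: val_inj.
move=> /andP[sn st]; exists s, t; split => //.
  by rewrite mem_iota add0n ltnS.
by rewrite IHk.
Qed.

Lemma chains_path k (t : k.-tuple nat) : chains k t <-> path geq (nth 0 t 0)%N t.
Proof.
rewrite /chains /part /=; split => [h|/(pathP 0%N) h i /andP[i0 ik]].
  apply/(pathP 0%N) => -[|i] /=; first by rewrite nth0; case: (tval t) => //=.
  by move=> it; apply: (h i.+1); rewrite -(size_tuple t).
case: i i0 ik => // i _ ik /=; have := h i.+1; rewrite size_tuple => /(_ ik) /=.
exact.
Qed.

Variables (K : numFieldType) (q : K).

(** The term of the chain [t] in entry [m] of [word q 1 cs]; the base case is the entry of the
    innermost sequence u. *)
Fixpoint chain_term (cs : seq nat) (m : nat) (t : seq nat) : K :=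
  match cs, t with
  | c :: cs', s :: t' =>
      q ^+ (s * s.-1 + c * s) / qpoch q q (m - s) * chain_term cs' s t'
  | _, _ => (qpoch q q m)^-1
  end.

Lemma word_chain_enum k cs n : size cs = k ->
  word q 1 cs n = \sum_(t <- chain_enum k n) chain_term cs n t.
Proof.
elim: k cs n => [|k IHk] [|c cs] n //; first by rewrite big_seq1.
move=> [hcs].
rewrite -[LHS]/(\sum_(s < n.+1) weight q 1 c (word q 1 cs) s / qpoch q q (n - s)).
rewrite /chain_enum -/chain_enum big_allpairs_dep.
rewrite -[iota 0%N n.+1]/(index_iota 0%N n.+1) big_mkord.
apply: eq_bigr => s _; rewrite /weight expr1n mul1r (IHk cs s hcs).
by rewrite mulrAC mulr_sumr.
Qed.

Lemma series_weight_chain_enum k c cs n : size cs = k ->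
  series (weight q 1 c (word q 1 cs)) n.+1 =
  \sum_(t <- chain_enum k.+1 n)
    q ^+ (nth 0 t 0 * (nth 0 t 0).-1 + c * nth 0 t 0)%N
      * chain_term cs (nth 0 t 0)%N (behead t).
Proof.
move=> hcs; rewrite /chain_enum -/chain_enum big_allpairs_dep.
rewrite -[iota 0%N n.+1]/(index_iota 0%N n.+1) /series /= !big_mkord.
apply: eq_bigr => s _; rewrite /weight expr1n mul1r (word_chain_enum s hcs).
by rewrite mulr_sumr.
Qed.

(** At the last index the default value 0 of [nth] supplies the factor (q)_(s_k). *)
Lemma chain_termE cs m t : size cs = size t ->
  chain_term cs m t =
  q ^+ (\sum_(i < size t)
        (nth 0 t i * (nth 0 t i).-1 + nth 0 cs i * nth 0 t i))%N /
  \prod_(i < (size t).+1) qpoch q q (nth 0 (m :: t) i - nth 0 t i)%N.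
Proof.
elim: cs m t => [|c cs IHcs] m [|s t] //=.
  by rewrite big_ord0 big_ord1 expr0 mul1r /= subn0.
move=> [/IHcs ->]; rewrite [in RHS]big_ord_recl [in RHS]exprD.
by rewrite [X in _ = _ / X]big_ord_recl /= invfM mulrACA.
Qed.

Lemma sum_part k (t : k.-tuple nat) (f : nat -> nat) (a b : nat) :
  (\sum_(a.+1 <= i < b.+1) f (part t i) = \sum_(a <= i < b) f (nth 0 t i))%N.
Proof. by rewrite big_add1 /=; apply: eq_bigr. Qed.

(** For c = 0, 1, 2 the expression s(s-1) + c s is s^2 - s, s^2, s^2 + s, as required on the first
    j, next m and last r entries. *)
Lemma exponentE j m r (t : (j + m + r).-tuple nat) :
  exponent j r t =
  (\sum_(i < j + m + r) (nth 0 t i * (nth 0 t i).-1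
     + nth 0 (nseq j 0 ++ nseq m 1 ++ nseq r 2) i * nth 0 t i))%N.
Proof.
rewrite /exponent (sum_part t (fun s => s ^ 2)%N) !(sum_part t id) addnK.
set X := (X in (X - _ + _)%N); set Y := (Y in (_ - Y + _)%N).
set Z := (Z in (_ - _ + Z)%N).
have YE : Y = (\sum_(0 <= i < j + m + r) (i < j) * nth 0 t i)%N.
  rewrite (@big_cat_nat _ _ _ j) ?leq0n //=; last by lia.
  rewrite [X in (_ + X)%N]big_nat_cond [X in (_ + X)%N]big1 ?addn0.
    rewrite /Y !big_nat; apply: eq_bigr => i /andP[_ ->]; exact/esym/mul1n.
  by move=> i; rewrite andbT => /andP[ji _]; rewrite ltnNge ji.
have ZE : Z = (\sum_(0 <= i < j + m + r) (j + m <= i) * nth 0 t i)%N.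
  rewrite [RHS](@big_cat_nat _ _ _ (j + m)) ?leq0n ?leq_addr //=.
  rewrite [X in (X + _)%N]big_nat_cond [X in (X + _)%N]big1 ?add0n.
    rewrite /Z !big_nat; apply: eq_bigr => i /andP[-> _]; exact/esym/mul1n.
  by move=> i; rewrite andbT => /andP[_ ji]; rewrite leqNgt ji.
have YX : (Y <= X)%N.
  rewrite YE; apply: leq_sum => i _; case: (i < j)%N; last by rewrite mul0n.
  by rewrite mul1n; case: (nth 0 t i)%N => // s; nia.
apply: (@addnI Y); rewrite addnA subnKC // YE ZE /X !big_mkord -!big_split /=.
apply: eq_bigr => i _; rewrite !nth_cat !size_nseq !nth_nseq.
have ir := ltn_ord i; set s := nth 0 t i.
have ss : (s ^ 2 = s * s.-1 + s)%N by case: (s) => // n; nia.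
rewrite ss; case: (ltnP i j) => h1.
  by rewrite (_ : (j + m <= i) = false)%N; lia.
case: (ltnP (i - j) m) => h2.
  by rewrite (_ : (j + m <= i) = false)%N; lia.
rewrite (_ : (i - j - m < r)%N); last by lia.
by rewrite (_ : (j + m <= i)%N); lia.
Qed.

End ChainEnumeration.

(** * The left-hand side as an unconditional sum *)

Section ChainSum.
Local Open Scope classical_set_scope.
Variables (K : numFieldType) (q : K).
Hypothesis (hK : dominated_series_cvg K) (hq : `|q| < 1).

(** The base [p] is a parameter because the family at |q| dominates the one at q. *)
Definition chain_weight (p : K) (cs t : seq nat) : K :=
  p ^+ (\sum_(i < size t)
        (nth 0 t i * (nth 0 t i).-1 + nth 0 cs i * nth 0 t i))%N /
  \prod_(i < size t) qpoch p p (nth 0 t i - nth 0 t i.+1)%N.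

Lemma qfact_inv_norm_le n : `|(qpoch q q n)^-1| <= (qpoch `|q| `|q| n)^-1.
Proof.
elim: n => [|n IHn]; first by rewrite !qpoch0 invr1 normr1.
rewrite !qpochS !invfM normrM; apply: ler_pM => //.
have q1 : 0 < 1 - `|q| ^+ n.+1 by rewrite subr_gt0 exprn_ilt1.
have h : 1 - `|q| ^+ n.+1 <= `|1 - q ^+ n.+1|.
  by apply: le_trans (lerB_dist _ _); rewrite normr1 normrX.
by rewrite normfV lef_pV2 // posrE // (lt_le_trans q1).
Qed.

Lemma chain_weight_norm cs t : `|chain_weight q cs t| <= chain_weight `|q| cs t.
Proof.
rewrite /chain_weight normrM normrX ler_wpM2l ?exprn_ge0 // -!prodfV normr_prod.
by apply: ler_prod => i _; rewrite normr_ge0 qfact_inv_norm_le.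
Qed.

Lemma cvg_chain_enum (p : K) k c cs : `|p| < 1 -> size cs = k ->
  (fun n => \sum_(t <- chain_enum k.+1 n) chain_weight p (c :: cs) t) @ \oo -->
    (wsum p 1 (c :: cs) : K^o).
Proof.
move=> hp hcs; have h1 : `|1 : K| <= 1 by rewrite normr1.
have -> : (fun n => \sum_(t <- chain_enum k.+1 n) chain_weight p (c :: cs) t) =
    (fun n => series (weight p 1 c (word p 1 cs)) n.+1).
  apply/funext => n; rewrite (series_weight_chain_enum p c n hcs).
  apply: eq_bigr => t _; case/tupleP: t => s t.
  rewrite /= chain_termE ?size_tuple // mulrA -exprD.
  by rewrite /chain_weight /= size_tuple big_ord_recl.
have := cvg_weight hK hp h1 (a := c) (tame_word hK hp h1 cs).
by move=> h; rewrite (cvg_shiftS (series _)).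
Qed.

(** The chains are exhausted by bounding s_1, with the same family at |q| as majorant. *)
Lemma has_sum_chains k cs : (0 < k)%N -> size cs = k ->
  has_sum (chains k) (fun t => chain_weight q cs t) (wsum q 1 cs).
Proof.
case: k cs => [|k] [|c cs] // _ [hcs].
apply: (@has_sum_exhaustion K _ _
  (fun t : k.+1.-tuple nat => chain_weight q (c :: cs) t)
  (fun t => chain_weight `|q| (c :: cs) t)
  (chain_enum k.+1) _ (wsum `|q| 1 (c :: cs))).
- exact: chain_enum_uniq.
- move=> n t; rewrite !mem_chain_enum; case: (tval t) => //= s s' /andP[h ->].
  by rewrite andbT; exact: leqW.
- move=> t; rewrite chains_path; split => [h|[n]].
    by exists (nth 0 t 0)%N; rewrite mem_chain_enum.
  by rewrite mem_chain_enum; case: (tval t) => //= s s' /andP[_ ->]; rewrite leqnn.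
- by move=> t; exact: chain_weight_norm.
- exact: cvg_chain_enum.
- by apply: cvg_chain_enum; rewrite ?normr_id.
Qed.

Lemma summandE j m r (t : (j + m + r).-tuple nat) :
  summand q j r t = chain_weight q (nseq j 0 ++ nseq m 1 ++ nseq r 2)%N t.
Proof.
rewrite /summand exponentE /chain_weight size_tuple; congr (_ / _).
by rewrite big_add1 /= big_mkord.
Qed.

End ChainSum.

(** * Enumerating the admissible frequency sequences *)

Section FrequencyEnumeration.

(** The argument [b] stands for the entry preceding the list. *)
Fixpoint path_enum (k N b : nat) : seq (seq nat) :=
  if N is N'.+1 then [seq c :: l | c <- iota 0%N (k - b).+1, l <- path_enum k N' c]
  else [:: [::]].

Lemma path_enum_uniq k N b : uniq (path_enum k N b).
Proof.
elim: N b => [//|N IHN] b; apply: allpairs_uniq_dep => [|c _|].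
- exact: iota_uniq.
- exact: IHN.
by move=> [c l] [c' l'] _ _ /= [-> ->].
Qed.

Lemma mem_path_enum k N b l : (b <= k)%N ->
  (l \in path_enum k N b) =
  (size l == N) && path (fun a c => a + c <= k)%N b l.
Proof.
elim: N b l => [|N IHN] b l bk; first by case: l.
apply/allpairsPdep/idP.
  move=> [c [l' [hc hl ->]]]; move: hc; rewrite mem_iota add0n ltnS => /= hc.
  rewrite eqSS andbCA -IHN ?hl ?andbT; first by lia.
  by apply: leq_trans hc _; exact: leq_subr.
case: l => [//|c l]; rewrite [path _ _ _]/= andbCA => /andP[h1 h2].
exists c, l; split => //; first by rewrite mem_iota add0n ltnS /=; lia.
by rewrite (IHN c l) //; lia.
Qed.

Definition freq_of_seq (l : seq nat) : freqseq :=
  [fsfun i in [fset i in iota 0%N (size l)]%fset => nth 0%N l i | 0%N].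

Lemma freq_of_seqE l i : freq_of_seq l i = nth 0%N l i.
Proof.
rewrite fsfunE !inE mem_iota add0n /=; case: ltnP => // h.
by rewrite nth_default.
Qed.

Lemma freq_of_seq_mkseq (f : freqseq) n : (forall i, (n <= i)%N -> f i = 0%N) ->
  freq_of_seq (mkseq f n) = f.
Proof.
move=> f0; apply/fsfunP => i; rewrite freq_of_seqE.
case: (ltnP i n) => h; first by rewrite nth_mkseq.
by rewrite nth_default ?size_mkseq // f0.
Qed.

Lemma freq_size_of_seq l :
  freq_size (freq_of_seq l) = (\sum_(i < size l) i * nth 0 l i)%N.
Proof.
rewrite /freq_size -(big_mkord xpredT (fun i => i * nth 0 l i)%N).
rewrite [RHS](bigID (fun i => i \in finsupp (freq_of_seq l))) /=.
rewrite [X in (_ + X)%N]big1 ?addn0; last first.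
  by move=> i; rewrite memNfinsupp freq_of_seqE => /eqP ->; rewrite muln0.
rewrite -[RHS]big_filter; under eq_bigr do rewrite freq_of_seqE.
apply: perm_big; apply: uniq_perm => [||i].
- exact: fset_uniq.
- by rewrite filter_uniq // iota_uniq.
rewrite mem_filter mem_index_iota leq0n /=.
case: (boolP (i \in finsupp _)) => //=; rewrite mem_finsupp freq_of_seqE.
by case: (ltnP i (size l)) => // h; rewrite nth_default.
Qed.

Variables (j r k : nat).
Hypothesis hjr : (j + r <= k)%N.

(** For f_0 = a <= j, the conditions a + f_1 <= k and a <= j - (a + f_1 - (k - r)) together say f_1
    <= k - max(a, 2a + r - j), so this maximum takes the place of the preceding entry. *)
Definition freq_enum (N : nat) : seq freqseq :=
  map freq_of_seq
    [seq a :: l | a <- iota 0%N j.+1, l <- path_enum k N (maxn a (a.*2 + r - j))].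

Let start_le a : (a <= j)%N -> (maxn a (a.*2 + r - j) <= k)%N.
Proof. lia. Qed.

Lemma freq_enum_uniq N : uniq (freq_enum N).
Proof.
rewrite map_inj_in_uniq.
  apply: allpairs_uniq_dep => [|c _|].
  - exact: iota_uniq.
  - exact: path_enum_uniq.
  by move=> [c l] [c' l'] _ _ /= [-> ->].
have hsize l : l \in [seq a :: l | a <- iota 0%N j.+1,
    l <- path_enum k N (maxn a (a.*2 + r - j))] -> size l = N.+1.
  move=> /allpairsPdep[a [l' [ha hl ->]]]; move: ha hl.
  rewrite mem_iota add0n ltnS => /= ha.
  by rewrite mem_path_enum ?start_le // => /andP[/eqP -> _].
move=> l l' /hsize sl /hsize sl' e; apply: (@eq_from_nth _ 0%N) => [|i _].
  by rewrite sl sl'.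
by rewrite -!freq_of_seqE e.
Qed.

Lemma admissibleE (f : freqseq) : admissible j r k f <->
  [/\ (f 0 <= j)%N, (maxn (f 0) ((f 0).*2 + r - j) + f 1 <= k)%N &
      forall i, (f i.+1 + f i.+2 <= k)%N].
Proof.
rewrite /admissible /=; split => [[h1 h2]|[h1 h2 h3]].
  by split => //; have := h1 0%N; lia.
split; last by lia.
by case => [|i] //; lia.
Qed.

Lemma mem_freq_enum N (f : freqseq) :
  f \in freq_enum N <-> admissible j r k f /\ forall i, (N < i)%N -> f i = 0%N.
Proof.
rewrite admissibleE; split.
  move=> /mapP[_ /allpairsPdep[a [l [ha hl ->]]] ->]; move: ha hl.
  rewrite mem_iota add0n ltnS => /= ha.
  rewrite mem_path_enum ?start_le // => /andP[/eqP hl /(pathP 0%N) pl].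
  split; last by move=> i Ni; rewrite freq_of_seqE nth_default //= hl.
  split; rewrite ?freq_of_seqE //=.
    case: N hl pl => [|N] hl pl; last by apply: (pl 0%N); rewrite hl.
    by rewrite nth_default ?hl // addn0 start_le.
  move=> i; rewrite !freq_of_seqE /=.
  case: (ltnP i.+1 N) => iN; first by apply: (pl i.+1); rewrite hl.
  rewrite [X in (_ + X)%N]nth_default ?hl // addn0.
  case: (ltnP i N) => iN'; last by rewrite nth_default ?hl.
  have := pl i; rewrite hl => /(_ iN') /=; apply: leq_trans; exact: leq_addl.
move=> [[h0 h1 h2] fN]; apply/mapP; exists (mkseq f N.+1); last first.
  by rewrite freq_of_seq_mkseq.
apply/allpairsPdep; exists (f 0%N), (mkseq (fun i => f i.+1) N).
split; first by rewrite mem_iota add0n ltnS.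
  rewrite mem_path_enum ?start_le // size_mkseq eqxx /=.
  apply/(pathP 0%N) => -[|i]; rewrite size_mkseq => iN.
    by rewrite nth_mkseq.
  by rewrite /= !nth_mkseq //; exact: ltnW.
by rewrite /mkseq /= -[1%N]addn0 iotaDl -map_comp.
Qed.

Variables (K : numFieldType).

Lemma freqsum_path_enum (q : K) N b i :
  freqsum q k N b i =
  \sum_(l <- path_enum k N b) q ^+ (\sum_(n < size l) (i.+1 + n) * nth 0 l n)%N.
Proof.
elim: N b i => [|N IHN] b i; first by rewrite /= big_seq1 big_ord0.
rewrite /path_enum -/path_enum big_allpairs_dep.
rewrite -[iota 0%N _]/(index_iota 0%N (k - b).+1) big_mkord /=.
apply: eq_bigr => c _; rewrite IHN mulr_sumr; apply: eq_bigr => l _.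
rewrite -exprD big_ord_recl /= addn0; congr (_ ^+ (_ + _)).
by apply: eq_bigr => n _; rewrite /bump /= add1n addSnnS.
Qed.

Lemma sum_freq_enum (q : K) N :
  \sum_(f <- freq_enum N) q ^+ freq_size f =
  \sum_(a < j.+1) freqsum q k N (maxn a (a.*2 + r - j)) 0.
Proof.
rewrite big_map big_allpairs_dep -[iota 0%N _]/(index_iota 0%N j.+1) big_mkord.
apply: eq_bigr => a _; rewrite freqsum_path_enum; apply: eq_bigr => l _.
rewrite freq_size_of_seq /= big_ord_recl mul0n add0n.
by congr (_ ^+ _); apply: eq_bigr => n _; rewrite /bump /= add1n.
Qed.

End FrequencyEnumeration.

(** * The sum over frequency sequences and the identity *)

Section Main.
Local Open Scope classical_set_scope.
Variables (K : numFieldType) (q : K).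
Hypothesis (hK : dominated_series_cvg K) (hq : `|q| < 1).

Lemma cvg_ord_sum n (u : 'I_n -> nat -> K) (l : 'I_n -> K) :
  (forall a, u a @ \oo --> (l a : K^o)) ->
  (fun N => \sum_(a < n) u a N) @ \oo --> (\sum_(a < n) l a : K^o).
Proof.
elim: n u l => [|n IHn] u l ul.
  by under eq_fun do rewrite big_ord0; rewrite big_ord0; exact: cvg_cst.
under eq_fun do rewrite big_ord_recl; rewrite big_ord_recl.
by apply: cvgD; [exact: ul|exact: IHn].
Qed.

Lemma cvg_freq_enum (p : K) j m r : `|p| < 1 ->
  (fun N => \sum_(f <- freq_enum j r (j + m + r) N) p ^+ freq_size f) @ \oo -->
    (wsum p 1 (nseq j 0 ++ nseq m 1 ++ nseq r 2)%N : K^o).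
Proof.
move=> hp; rewrite wsum_agsum //.
under eq_fun do rewrite sum_freq_enum.
(* The point x = 1 is p^0, that is, i = 0 in [cvg_freqsum]. *)
apply: cvg_ord_sum => a; rewrite -(expr0 p); apply: cvg_freqsum => //.
by have := ltn_ord a; lia.
Qed.

Lemma has_sum_admissible j m r :
  has_sum (admissible j r (j + m + r)) (fun f => q ^+ freq_size f)
    (wsum q 1 (nseq j 0 ++ nseq m 1 ++ nseq r 2)%N).
Proof.
have hjr : (j + r <= j + m + r)%N by lia.
apply: (@has_sum_exhaustion _ _ _ _ (fun f => `|q| ^+ freq_size f)
  (freq_enum j r (j + m + r)) _ (wsum `|q| 1 (nseq j 0 ++ nseq m 1 ++ nseq r 2)%N)).
- by move=> n; exact: freq_enum_uniq.
- move=> n f /(mem_freq_enum hjr) [fa fn]; apply/(mem_freq_enum hjr).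
  by split => // i ni; apply: fn; exact: ltnW.
- move=> f; split => [fa|[n /(mem_freq_enum hjr) []//]].
  (* The largest index in the support bounds the length needed. *)
  exists (\max_(i <- enum_fset (finsupp f)) i)%N.
  apply/(mem_freq_enum hjr); split => // i; apply: contraTeq => fi0.
  by rewrite -leqNgt; apply: leq_bigmax_seq; rewrite ?mem_finsupp.
- by move=> f; rewrite normrX.
- exact: cvg_freq_enum.
- by apply: cvg_freq_enum; rewrite normr_id.
Qed.

End Main.

Theorem theorem1p14 (R : realType) (j r k : nat) (hk : (1 <= k)%N)
    (hjr : (j + r <= k)%N) (q : R[i]) (hq : `|q| < 1) :
  exists S : R[i],
    has_sum (chains k) (fun s => summand q j r s) S /\
    has_sum (admissible j r k) (fun f => q ^+ freq_size f) S.
Proof.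
have [m hkm] : exists m, k = (j + m + r)%N by exists (k - j - r)%N; lia.
subst k; have hK := @complex_dominated_series_cvg R.
(* The common value is lam (T_0^j T_1^m T_2^r u) at x = 1, with m = k - j - r. *)
exists (wsum q 1 (nseq j 0 ++ nseq m 1 ++ nseq r 2)%N); split.
  have -> : (fun s => summand q j r s) =
    (fun t : (j + m + r).-tuple nat =>
       chain_weight q (nseq j 0 ++ nseq m 1 ++ nseq r 2)%N t).
    by apply/funext => t; exact: summandE.
  apply: has_sum_chains => //.
  by rewrite !size_cat !size_nseq addnA.
exact: has_sum_admissible.
Qed.
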